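(* Let $k,\mu,h>0$, $\alpha=\frac{\mu}{kh}$, let $q\in\mathbb{R}$ be a given total rate, let $L>0$, $\theta>0$ and $M\in\mathbb{N}$ be such that $$\Delta:=\frac{L}{M}>e^{\pi/2}\,\theta ,$$ and let $p_0,p_1$ be real numbers satisfying the balance equation $p_1-p_0=\frac{\alpha}{4}q$. If $$R_0=\Delta\cdot e^{-\pi/2},$$ then the Peaceman problem in the annular domains $U(R_0,\theta)$ and $U(\Delta,\theta)$ is strictly well posed (with this $R_0$).
   Context: For $0<\theta<R$ let $B(0,R)\subset\mathbb{R}^2$ be the disc of radius $R$ centred at $0$, $U(R,\theta)=B(0,R)\setminus B(0,\theta)$, and $\Gamma_\theta=\{|x|=\theta\}$. Given $\theta<R_0<\Delta$, consider two radial (depending only on $r=|x|$) solutions: - $u_1$: $\nabla^2 u_1=0$ in $U(\Delta,\theta)$, $\ h\frac{k}{\mu}\int_{\Gamma_\theta}\frac{\partial u_1}{\partial\nu}\,ds=q$, $\ u_1=p_1$ on $\partial B(0,\Delta)$; - $u_0$: $\nabla^2 u_0=0$ in $U(R_0,\theta)$, $\ h\frac{k}{\mu}\int_{\Gamma_\theta}\frac{\partial u_0}{\partial\nu}\,ds=q$, $\ u_0=p_0$ on $\partial B(0,R_0)$. Here $\nu$ on $\Gamma_\theta$ is the unit normal pointing away from the origin. Definition. With $\theta$ and $q$ fixed, the Peaceman problem in the annular domains $U(R_0,\theta)$ and $U(\Delta,\theta)$ is called strictly well posed if there is $R_0$ with $\theta<R_0<\Delta$ such that simultaneously: (1) $u_1$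 and $u_0$ are constant on $\Gamma_\theta$ and $u_1|_{r=\theta}=u_0|_{r=\theta}$; (2) $p_1$ and $p_0$ satisfy the balance equation $p_1-p_0=\frac{\alpha}{4}q$. *)

(* Defs.v *)
(* Stdlib real numbers with Coquelicot; the plane R^2 is the type R * R. *)
From Stdlib Require Import Reals.
From Coquelicot Require Import Coquelicot.
Open Scope R_scope.

Definition radius (z : R * R) : R := sqrt (fst z ^ 2 + snd z ^ 2).

Definition circle (r : R) (z : R * R) : Prop := radius z = r.

(* U(rho, theta) as an open set: the differential equation holds at its points,
   and the boundary conditions are imposed on the two circles. *)
Definition annulus (rho theta : R) (z : R * R) : Prop :=
  theta < radius z < rho.

Definition closed_annulus (rho theta : R) (z : R * R) : Prop :=
  theta <= radius z <= rho.

Definition partial1 (u : R * R -> R) (z : R * R) : R :=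
  Derive (fun s => u (s, snd z)) (fst z).

Definition partial2 (u : R * R -> R) (z : R * R) : R :=
  Derive (fun s => u (fst z, s)) (snd z).

(* [D] is meant to be open.  [Derive] is total, so existence of the partial
   derivatives is required explicitly. *)
Definition C1_on (D : R * R -> Prop) (u : R * R -> R) : Prop :=
  forall z, D z ->
    ex_derive (fun s => u (s, snd z)) (fst z) /\
    ex_derive (fun s => u (fst z, s)) (snd z) /\
    continuous (partial1 u) z /\
    continuous (partial2 u) z.

Definition C2_on (D : R * R -> Prop) (u : R * R -> R) : Prop :=
  C1_on D u /\ C1_on D (partial1 u) /\ C1_on D (partial2 u).

Definition laplacian (u : R * R -> R) (z : R * R) : R :=
  partial1 (partial1 u) z + partial2 (partial2 u) z.

Definition harmonic_on (D : R * R -> Prop) (u : R * R -> R) : Prop :=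
  C2_on D u /\ forall z, D z -> laplacian u z = 0.

Definition radial_on (D : R * R -> Prop) (u : R * R -> R) : Prop :=
  forall z w, D z -> D w -> radius z = radius w -> u z = u w.

Definition constant_on (D : R * R -> Prop) (u : R * R -> R) : Prop :=
  exists c, forall z, D z -> u z = c.

Definition circle_point (theta t : R) : R * R :=
  (theta * cos t, theta * sin t).

(* The derivative at [circle_point theta t] along the unit normal
   nu = (cos t, sin t), which points away from the origin.  It is one-sided
   because the function is only meaningful for theta <= |z|. *)
Definition is_normal_derive (u : R * R -> R) (theta t d : R) : Prop :=
  filterlim
    (fun s => (u (circle_point (theta + s) t) - u (circle_point theta t)) / s)
    (at_right 0) (locally d).

(* The integral of the normal derivative over the circle of radius [theta] with
   respect to arc length, ds = theta dt, exists and equals [flux]. *)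
Definition is_circle_flux (u : R * R -> R) (theta flux : R) : Prop :=
  exists g : R -> R,
    (forall t, is_normal_derive u theta t (g t)) /\
    is_RInt (fun t => g t * theta) 0 (2 * PI) flux.

(* Only the values of [u] on the closed annulus matter. *)
Definition radial_solution (k mu h q theta rho p : R) (u : R * R -> R) : Prop :=
  radial_on (closed_annulus rho theta) u /\
  continuous_on (closed_annulus rho theta) u /\
  harmonic_on (annulus rho theta) u /\
  (exists flux, is_circle_flux u theta flux /\ h * (k / mu) * flux = q) /\
  (forall z, circle rho z -> u z = p).

Definition alpha (k mu h : R) : R := mu / (k * h).

(* The solutions u1 and u0 are required to exist, and the conditions are
   required of every such pair of solutions. *)
Definition strictly_well_posed_with
    (k mu h q theta Delta p0 p1 R0 : R) : Prop :=
  theta < R0 < Delta /\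
  (exists u1, radial_solution k mu h q theta Delta p1 u1) /\
  (exists u0, radial_solution k mu h q theta R0 p0 u0) /\
  (forall u1 u0 : R * R -> R,
     radial_solution k mu h q theta Delta p1 u1 ->
     radial_solution k mu h q theta R0 p0 u0 ->
     constant_on (circle theta) u1 /\
     constant_on (circle theta) u0 /\
     (forall z, circle theta z -> u1 z = u0 z)) /\
  p1 - p0 = alpha k mu h / 4 * q.

(* Strict well-posedness is the existence of a suitable R0. *)
Definition strictly_well_posed (k mu h q theta Delta p0 p1 : R) : Prop :=
  exists R0, strictly_well_posed_with k mu h q theta Delta p0 p1 R0.

(* Main.v *)
Require Import Defs.
From Stdlib Require Import Reals Lra.
From Coquelicot Require Import Coquelicot.
Open Scope R_scope.

(** A radial harmonic function on an annulus satisfies f'' + f'/r = 0, hence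
    (r f')' = 0, so it equals A ln r + B, and its flux through the inner circle
    is 2 PI A.  The flux condition therefore gives A = alpha q / (2 PI) for both
    solutions.  On the inner circle they differ by
    p1 - p0 - A ln (Delta / R0) = alpha q / 4 - A ln (Delta / R0), which
    vanishes exactly because ln (Delta / R0) = PI / 2. *)

(** * Radius in polar and Cartesian coordinates *)

Lemma radius_circle_point (r t : R) : 0 <= r -> radius (circle_point r t) = r.
Proof.
intros Hr. unfold radius, circle_point; simpl fst; simpl snd.
replace ((r * cos t) ^ 2 + (r * sin t) ^ 2) with (r ^ 2 * (Rsqr (sin t) + Rsqr (cos t)))
  by (unfold Rsqr; ring).
rewrite sin2_cos2, Rmult_1_r. now apply sqrt_pow2.
Qed.

Lemma radius_axis (r : R) : 0 <= r -> radius (r, 0) = r.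
Proof.
intros Hr. unfold radius; simpl fst; simpl snd.
replace (r ^ 2 + 0 ^ 2) with (r ^ 2) by ring. now apply sqrt_pow2.
Qed.

Lemma radius_pos_sqr (z : R * R) : 0 < radius z -> 0 < fst z ^ 2 + snd z ^ 2.
Proof.
intros Hz. destruct (Rle_or_lt (fst z ^ 2 + snd z ^ 2) 0) as [H | H]; auto.
(* [sqrt] takes the default value 0 on nonpositive reals, which contradicts [0 < radius z]. *)
exfalso. unfold radius in Hz. rewrite sqrt_neg_0 in Hz; lra.
Qed.

Lemma ln_radius (z : R * R) :
  0 < radius z -> ln (radius z) = / 2 * ln (fst z ^ 2 + snd z ^ 2).
Proof.
intros Hz. pose proof (radius_pos_sqr z Hz) as H.
rewrite <- (sqrt_sqrt (fst z ^ 2 + snd z ^ 2)) at 1 by lra.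
fold (radius z). rewrite ln_mult by assumption. field.
Qed.

(** * Continuity of real expressions and openness of annuli *)

Section RealContinuity.

Context {U : UniformSpace}.
Implicit Types (f g : U -> R) (z : U).

Lemma continuous_Rplus f g z :
  continuous f z -> continuous g z -> continuous (fun w => f w + g w) z.
Proof. exact (continuous_plus f g z). Qed.

Lemma continuous_Rminus f g z :
  continuous f z -> continuous g z -> continuous (fun w => f w - g w) z.
Proof. exact (continuous_minus f g z). Qed.

Lemma continuous_Rmult f g z :
  continuous f z -> continuous g z -> continuous (fun w => f w * g w) z.
Proof. exact (continuous_mult f g z). Qed.

Lemma continuous_Rdiv f g z :
  continuous f z -> continuous g z -> g z <> 0 ->
  continuous (fun w => f w / g w) z.
Proof.
intros Hf Hg H0. apply continuous_Rmult; auto.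
apply (continuous_comp g Rinv); auto. now apply continuous_Rinv.
Qed.

Lemma continuous_pow f (n : nat) z :
  continuous f z -> continuous (fun w => f w ^ n) z.
Proof.
intros Hf. induction n as [| n IH]; simpl.
- apply continuous_const.
- now apply continuous_Rmult.
Qed.

End RealContinuity.

Lemma continuous_fst_R (z : R * R) : continuous (fun w : R * R => fst w) z.
Proof. destruct z; apply continuous_fst. Qed.

Lemma continuous_snd_R (z : R * R) : continuous (fun w : R * R => snd w) z.
Proof. destruct z; apply continuous_snd. Qed.

(** Goals of any other shape are left to the caller, in particular the nonvanishing of the
    denominator of each quotient. *)
Ltac solve_continuous :=
  lazymatch goal with
  | |- continuous fst _ => apply continuous_fst_R
  | |- continuous snd _ => apply continuous_snd_R
  | |- continuous (fun w => fst w) _ => apply continuous_fst_R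
  | |- continuous (fun w => snd w) _ => apply continuous_snd_R
  | |- continuous (fun w => _ + _) _ => apply continuous_Rplus; solve_continuous
  | |- continuous (fun w => _ - _) _ => apply continuous_Rminus; solve_continuous
  | |- continuous (fun w => _ * _) _ => apply continuous_Rmult; solve_continuous
  | |- continuous (fun w => _ / _) _ => apply continuous_Rdiv; solve_continuous
  | |- continuous (fun w => _ ^ _) _ => apply continuous_pow; solve_continuous
  | |- continuous (fun _ => _) _ => apply continuous_const
  | |- _ => idtac
  end.

Lemma continuous_radius (z : R * R) : continuous radius z.
Proof.
apply (continuous_comp (fun w : R * R => fst w ^ 2 + snd w ^ 2) sqrt).
- solve_continuous.
- apply continuous_sqrt.
Qed.

Lemma open_annulus (rho theta : R) : open (annulus rho theta).
Proof.
apply open_and.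
- apply (open_comp radius (fun r => theta < r)).
  + intros; apply continuous_radius.
  + apply open_gt.
- apply (open_comp radius (fun r => r < rho)).
  + intros; apply continuous_radius.
  + apply open_lt.
Qed.

Lemma open_radius_pos : open (fun z : R * R => 0 < radius z).
Proof.
apply (open_comp radius (fun r => 0 < r)).
- intros; apply continuous_radius.
- apply open_gt.
Qed.

(** * Partial derivatives on open sets *)

Lemma locally_slice1 (D : R * R -> Prop) (z : R * R) :
  open D -> D z -> locally (fst z) (fun s => D (s, snd z)).
Proof.
intros HD Hz. destruct (HD z Hz) as [e He]. exists e; intros s Hs.
apply He; split; [exact Hs | apply ball_center].
Qed.

Lemma locally_slice2 (D : R * R -> Prop) (z : R * R) :
  open D -> D z -> locally (snd z) (fun s => D (fst z, s)).
Proof.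
intros HD Hz. destruct (HD z Hz) as [e He]. exists e; intros s Hs.
apply He; split; [apply ball_center | exact Hs].
Qed.

Section Extensionality.

Variables (D : R * R -> Prop) (u v : R * R -> R).
Hypotheses (HD : open D) (Huv : forall z, D z -> u z = v z).

Lemma partial1_ext_on (z : R * R) : D z -> partial1 u z = partial1 v z.
Proof.
intros Hz. apply Derive_ext_loc.
apply (filter_imp (fun s => D (s, snd z))); [intros s Hs; now apply Huv |].
now apply locally_slice1.
Qed.

Lemma partial2_ext_on (z : R * R) : D z -> partial2 u z = partial2 v z.
Proof.
intros Hz. apply Derive_ext_loc.
apply (filter_imp (fun s => D (fst z, s))); [intros s Hs; now apply Huv |].
now apply locally_slice2.
Qed.

(** Differentiability and continuity are local, and an open [D] is a neighbourhood of each of its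
    points. This lets a closed formula valid only on [D] stand in for a partial derivative. *)
Lemma C1_on_ext : C1_on D v -> C1_on D u.
Proof.
intros Hv z Hz. destruct (Hv z Hz) as (H1 & H2 & H3 & H4). repeat split.
- apply ex_derive_ext_loc with (2 := H1).
  apply (filter_imp (fun s => D (s, snd z))); [intros s Hs; symmetry; now apply Huv |].
  now apply locally_slice1.
- apply ex_derive_ext_loc with (2 := H2).
  apply (filter_imp (fun s => D (fst z, s))); [intros s Hs; symmetry; now apply Huv |].
  now apply locally_slice2.
- apply continuous_ext_loc with (2 := H3).
  apply (filter_imp D); [| now apply HD].
  intros w Hw; symmetry; now apply partial1_ext_on.
- apply continuous_ext_loc with (2 := H4).
  apply (filter_imp D); [| now apply HD].
  intros w Hw; symmetry; now apply partial2_ext_on.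
Qed.

End Extensionality.

(** Reduces the C1 property to explicit candidates [a] and [b] for the gradient: uniqueness of
    derivatives identifies them with the partials on [D], and openness of [D] then transfers their
    continuity. *)
Lemma C1_on_intro (D : R * R -> Prop) (u a b : R * R -> R) :
  open D ->
  (forall z, D z -> is_derive (fun s => u (s, snd z)) (fst z) (a z)) ->
  (forall z, D z -> is_derive (fun s => u (fst z, s)) (snd z) (b z)) ->
  (forall z, D z -> continuous a z) ->
  (forall z, D z -> continuous b z) ->
  C1_on D u /\
  (forall z, D z -> partial1 u z = a z) /\ (forall z, D z -> partial2 u z = b z).
Proof.
intros HD Ha Hb Ca Cb.
assert (Ea : forall z, D z -> partial1 u z = a z)
  by (intros z Hz; apply is_derive_unique; now apply Ha).
assert (Eb : forall z, D z -> partial2 u z = b z)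
  by (intros z Hz; apply is_derive_unique; now apply Hb).
split; [| now split]. intros z Hz. repeat split.
- eexists; now apply Ha.
- eexists; now apply Hb.
- apply continuous_ext_loc with (2 := Ca z Hz).
  apply (filter_imp D); [| now apply HD]. intros w Hw; symmetry; now apply Ea.
- apply continuous_ext_loc with (2 := Cb z Hz).
  apply (filter_imp D); [| now apply HD]. intros w Hw; symmetry; now apply Eb.
Qed.

(** * The logarithmic profile and its harmonicity *)

Definition log_profile (A B : R) (z : R * R) : R :=
  A / 2 * ln (fst z ^ 2 + snd z ^ 2) + B.

Lemma log_profile_radius (A B : R) (z : R * R) :
  0 < radius z -> log_profile A B z = A * ln (radius z) + B.
Proof. intros Hz. rewrite ln_radius by assumption. unfold log_profile; field. Qed.

(** Having x^2 + y^2 inside the logarithm instead of the radius keeps square roots out of all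
    derivatives, so every partial is a rational function with a power of x^2 + y^2 as
    denominator. *)
Lemma log_profile_harmonic (A B : R) :
  harmonic_on (fun z => 0 < radius z) (log_profile A B).
Proof.
set (D := fun z : R * R => 0 < radius z).
assert (HD : open D) by apply open_radius_pos.
set (sq := fun z : R * R => fst z ^ 2 + snd z ^ 2).
(* [a], [b] form the gradient and [aa], [ab], [bb] the Hessian; [aa] and [bb] are opposite, so the
   Laplacian vanishes. *)
set (a := fun z : R * R => A * fst z / sq z).
set (b := fun z : R * R => A * snd z / sq z).
set (aa := fun z : R * R => A * (snd z ^ 2 - fst z ^ 2) / sq z ^ 2).
set (ab := fun z : R * R => - 2 * A * fst z * snd z / sq z ^ 2).
set (bb := fun z : R * R => A * (fst z ^ 2 - snd z ^ 2) / sq z ^ 2).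
destruct (C1_on_intro D (log_profile A B) a b HD) as (C0 & Ea & Eb).
1, 2: intros [x y] Hz; pose proof (radius_pos_sqr _ Hz) as HN;
  unfold log_profile, a, b, sq; simpl fst in *; simpl snd in *;
  auto_derive; [lra | field; simpl in *; lra].
1, 2: intros z Hz; pose proof (radius_pos_sqr _ Hz) as HN;
  unfold a, b, sq; solve_continuous; lra.
destruct (C1_on_intro D a aa ab HD) as (C1 & Eaa & _).
1, 2: intros [x y] Hz; pose proof (radius_pos_sqr _ Hz) as HN;
  unfold a, aa, ab, sq; simpl fst in *; simpl snd in *;
  auto_derive; [lra | field; simpl in *; lra].
1, 2: intros z Hz; pose proof (radius_pos_sqr _ Hz) as HN;
  unfold aa, ab, sq; solve_continuous; apply pow_nonzero; lra.
destruct (C1_on_intro D b ab bb HD) as (C2 & _ & Ebb).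
1, 2: intros [x y] Hz; pose proof (radius_pos_sqr _ Hz) as HN;
  unfold b, bb, ab, sq; simpl fst in *; simpl snd in *;
  auto_derive; [lra | field; simpl in *; lra].
1, 2: intros z Hz; pose proof (radius_pos_sqr _ Hz) as HN;
  unfold bb, ab, sq; solve_continuous; apply pow_nonzero; lra.
split; [split; [exact C0 | split] |].
- now apply C1_on_ext with (v := a).
- now apply C1_on_ext with (v := b).
- intros z Hz. unfold laplacian.
  rewrite (partial1_ext_on D _ a), (partial2_ext_on D _ b) by assumption.
  rewrite Eaa, Ebb by assumption. pose proof (radius_pos_sqr _ Hz) as HN. unfold aa, bb, sq. field. lra.
Qed.

Lemma harmonic_on_subset (D E : R * R -> Prop) (u : R * R -> R) :
  (forall z, E z -> D z) -> harmonic_on D u -> harmonic_on E u.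
Proof.
intros HED ((H0 & H1 & H2) & HL).
split; [split; [| split] |]; intros z Hz; auto.
Qed.

(** * Classification of radial harmonic functions *)

Lemma is_derive_0_constant (g : R -> R) (a b : R) :
  (forall t, a < t < b -> is_derive g t 0) ->
  exists c, forall t, a < t < b -> g t = c.
Proof.
(* The midpoint serves as a base point inside the open interval; an empty interval makes the claim
   vacuous. *)
intros Hg. exists (g ((a + b) / 2)). intros t Ht.
destruct (Rtotal_order t ((a + b) / 2)) as [H | [H | H]].
- apply eq_is_derive; [| exact H]. intros s Hs; apply Hg; lra.
- now rewrite <- H.
- symmetry. apply eq_is_derive; [| exact H]. intros s Hs; apply Hg; lra.
Qed.

Lemma is_derive_radius2 (x y : R) :
  0 < radius (x, y) -> is_derive (fun s => radius (x, s)) y (y / radius (x, y)).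
Proof.
intros H. pose proof (radius_pos_sqr _ H) as HN. simpl fst in HN; simpl snd in HN.
unfold radius in *; simpl fst in *; simpl snd in *.
auto_derive; [lra |]. simpl in *. field. lra.
Qed.

(** The Laplace equation is read off at the axis points (r, 0) only. With f the restriction of u to
    the axis, u_xx is f'' there, and radiality gives u_yy = f'/r. Here [f1] is f'. *)
Lemma radial_harmonic_ode (theta rho : R) (u : R * R -> R) :
  0 <= theta ->
  radial_on (annulus rho theta) u -> harmonic_on (annulus rho theta) u ->
  exists f1 : R -> R, forall r, theta < r < rho ->
    is_derive (fun s => u (s, 0)) r (f1 r) /\ is_derive f1 r (- f1 r / r).
Proof.
intros Ht Hrad ((H0 & H1 & H2) & HL).
set (f := fun s => u (s, 0)). set (f1 := fun s => partial1 u (s, 0)).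
exists f1. pose proof (open_annulus rho theta) as HD.
assert (Hax : forall r, theta < r < rho -> annulus rho theta (r, 0)).
{ intros r Hr. unfold annulus. rewrite radius_axis; lra. }
assert (Df : forall r, theta < r < rho -> is_derive f r (f1 r)).
{ intros r Hr. apply Derive_correct. apply (H0 _ (Hax r Hr)). }
(* The chain rule for u = f(|z|), needed off the axis as well because this expression is
   differentiated once more in y. *)
assert (Hp2 : forall z, annulus rho theta z ->
  partial2 u z = f1 (radius z) * (snd z / radius z)).
{ intros [x y] Hz. apply is_derive_unique; simpl fst; simpl snd.
  assert (Hz0 : 0 < radius (x, y)) by (destruct Hz; lra).
  apply is_derive_ext_loc with (f := fun s => f (radius (x, s))).
  - apply (filter_imp (fun s => annulus rho theta (x, s))).
    + intros s Hs. unfold f. symmetry. apply Hrad; auto.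
      rewrite radius_axis; auto. destruct Hs; lra.
    + now apply (locally_slice2 _ (x, y)).
  - rewrite Rmult_comm.
    apply (is_derive_comp f (fun s => radius (x, s))).
    + now apply Df.
    + now apply is_derive_radius2. }
intros r Hr. split; [now apply Df |].
assert (Hf1 : is_derive f1 r (partial1 (partial1 u) (r, 0))).
{ apply Derive_correct. apply (H1 _ (Hax r Hr)). }
assert (H22 : partial2 (partial2 u) (r, 0) = f1 r / r).
{ rewrite (partial2_ext_on (annulus rho theta) _ _ HD Hp2) by auto.
  apply is_derive_unique; simpl fst; simpl snd.
  assert (E : radius (r, 0) = r) by (apply radius_axis; lra).
  assert (E0 : radius (r, 0) <> 0) by lra.
  (* Leaving the axis vertically changes the radius only to second order. In the product rule for
     f1(|z|) * (y / |z|) at y = 0, only f1(r) * (1 / r) survives. *)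
  assert (DR : is_derive (fun s => radius (r, s)) 0 0).
  { replace 0 with (0 / radius (r, 0)) at 2 by (unfold Rdiv; ring).
    apply is_derive_radius2. lra. }
  rewrite <- E in Hf1 at 1.
  assert (DF : is_derive (fun s => f1 (radius (r, s))) 0 0).
  { rewrite <- (Rmult_0_l (partial1 (partial1 u) (r, 0))) at 2.
    apply (is_derive_comp f1 (fun s => radius (r, s))); assumption. }
  assert (DQ : is_derive (fun s => s / radius (r, s)) 0 (/ r)).
  { replace (/ r) with ((1 * radius (r, 0) - 0 * 0) / radius (r, 0) ^ 2)
      by (rewrite E; field; lra).
    apply (is_derive_div (fun s => s)); [exact (is_derive_id (K := R_AbsRing) 0) | exact DR | exact E0]. }
  replace (f1 r / r) with (0 * (0 / radius (r, 0)) + f1 (radius (r, 0)) * / r)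
    by (rewrite E; field; lra).
  apply (is_derive_mult (fun s => f1 (radius (r, s))) (fun s => s / radius (r, s)));
    auto. exact Rmult_comm. }
pose proof (HL _ (Hax r Hr)) as Lz. unfold laplacian in Lz. rewrite H22 in Lz.
replace (- f1 r / r) with (partial1 (partial1 u) (r, 0)); [exact Hf1 |].
replace (- f1 r / r) with (- (f1 r / r)) by (field; lra). lra.
Qed.

Lemma radial_harmonic_log (theta rho : R) (u : R * R -> R) :
  0 <= theta ->
  radial_on (annulus rho theta) u -> harmonic_on (annulus rho theta) u ->
  exists A B, forall z, annulus rho theta z -> u z = A * ln (radius z) + B.
Proof.
intros Ht Hrad Hharm.
destruct (radial_harmonic_ode theta rho u Ht Hrad Hharm) as [f1 Hf1].
(* First integration: (r f')' = f' + r (-f'/r) = 0. The second, below, uses (f - A ln r)' = f' - A/r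
   = 0. *)
destruct (is_derive_0_constant (fun r => r * f1 r) theta rho) as [A HA].
{ intros r Hr. destruct (Hf1 r Hr) as [_ H].
  replace 0 with (1 * f1 r + r * (- f1 r / r)) by (field; lra).
  apply (is_derive_mult (fun s => s) f1); auto.
  - exact (is_derive_id (K := R_AbsRing) r).
  - exact Rmult_comm. }
destruct (is_derive_0_constant (fun r => u (r, 0) - A * ln r) theta rho) as [B HB].
{ intros r Hr. destruct (Hf1 r Hr) as [H _].
  assert (Hln : is_derive (fun s => A * ln s) r (A * / r))
    by (apply (is_derive_scal ln), is_derive_ln; lra).
  assert (HD : is_derive (fun s => u (s, 0) - A * ln s) r (f1 r - A * / r))
    by exact (is_derive_minus _ _ _ _ _ H Hln).
  replace (f1 r - A * / r) with 0 in HD by (rewrite <- (HA r Hr); field; lra).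
  exact HD. }
exists A, B. intros z Hz.
(* Radiality carries the formula from the axis point (|z|, 0) to z. *)
assert (E : radius (radius z, 0) = radius z) by (apply radius_axis; destruct Hz; lra).
rewrite (Hrad z (radius z, 0)); auto.
- rewrite <- (HB (radius z) Hz). ring.
- unfold annulus; now rewrite E.
Qed.

(** Continuity is relative to the closed annulus, so the axis may be followed only through radii
    between [theta] and [rho]. An abstract filter [F] covers approach from either side. *)
Lemma continuous_on_closed_annulus_limit
    (theta rho r : R) (u : R * R -> R) (F : (R -> Prop) -> Prop) {FF : Filter F} :
  0 <= theta -> theta <= r <= rho ->
  continuous_on (closed_annulus rho theta) u ->
  filter_le F (locally r) -> F (fun s => theta < s < rho) ->
  filterlim (fun s => u (s, 0)) F (locally (u (r, 0))).
Proof.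
intros Ht Hr Hc HF HFi.
apply filterlim_comp with (g := u)
  (G := within (closed_annulus rho theta) (locally (r, 0))).
- intros P [e He]. unfold filtermap.
  apply (filter_imp (fun s => ball r e s /\ theta < s < rho)).
  + intros s [Hs Hi]. apply He.
    * split; [exact Hs | apply ball_center].
    * unfold closed_annulus. rewrite radius_axis; lra.
  + apply filter_and; [| exact HFi]. apply HF. now exists e.
- apply Hc. unfold closed_annulus. rewrite radius_axis; lra.
Qed.

Lemma radial_harmonic_log_closed (theta rho : R) (u : R * R -> R) :
  0 < theta < rho ->
  radial_on (closed_annulus rho theta) u ->
  continuous_on (closed_annulus rho theta) u ->
  harmonic_on (annulus rho theta) u ->
  exists A B, forall z, closed_annulus rho theta z -> u z = A * ln (radius z) + B.
Proof.
intros Ht Hrad Hc Hh.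
destruct (radial_harmonic_log theta rho u) as (A & B & HAB); [lra | | exact Hh |].
{ intros z w Hz Hw. apply Hrad; unfold annulus, closed_annulus in *; lra. }
exists A, B.
(* Along [F] the values u(s, 0) tend both to u(r, 0) and to A ln r + B; uniqueness of limits extends
   the formula to the boundary radii. *)
assert (Hlim : forall r (F : (R -> Prop) -> Prop), ProperFilter F ->
  theta <= r <= rho -> filter_le F (locally r) ->
  F (fun s => theta < s < rho) -> u (r, 0) = A * ln r + B).
{ intros r F HFF Hr HF HFi.
  apply (filterlim_locally_unique (F := F) (fun s => u (s, 0))).
  - apply continuous_on_closed_annulus_limit with theta rho; auto; lra || apply HFF.
  - apply filterlim_ext_loc with (f := fun s => A * ln s + B).
    + apply (filter_imp (fun s => theta < s < rho)); [| exact HFi].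
      intros s Hs. symmetry. rewrite HAB.
      * rewrite radius_axis; lra.
      * unfold annulus. rewrite radius_axis; lra.
    + apply filterlim_filter_le_1 with (1 := HF).
      apply (ex_derive_continuous (fun s => A * ln s + B)).
      auto_derive. lra. }
intros z Hz.
assert (E : radius (radius z, 0) = radius z) by (apply radius_axis; destruct Hz; lra).
rewrite (Hrad z (radius z, 0)); auto; [| unfold closed_annulus; now rewrite E].
destruct Hz as [Hz1 Hz2].
(* The outer circle is approached from smaller radii; every other radius, the inner one included,
   from larger radii. *)
destruct (Req_dec (radius z) rho) as [Er | Nr].
- apply (Hlim _ (at_left (radius z))); [apply at_left_proper_filter | lra | |].
  + apply filter_le_within.
  + apply (locally_interval _ _ theta p_infty); simpl; auto; lra || intros; lra.
- apply (Hlim _ (at_right (radius z))); [apply at_right_proper_filter | lra | |].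
  + apply filter_le_within.
  + apply (locally_interval _ _ m_infty rho); simpl; auto; lra || intros; lra.
Qed.

(** * Flux through the inner circle *)

Lemma is_normal_derive_log (theta rho A B t : R) (u : R * R -> R) :
  0 < theta < rho ->
  (forall z, closed_annulus rho theta z -> u z = A * ln (radius z) + B) ->
  is_normal_derive u theta t (A / theta).
Proof.
intros Ht Hu.
assert (HD : is_derive (fun r => A * ln r + B) theta (A / theta)).
{ auto_derive; [lra | field; lra]. }
apply is_derive_Reals in HD.
intros P [e He]. destruct (HD e (cond_pos e)) as [d Hd].
unfold filtermap.
(* The bound [s < rho - theta] keeps the point of the ray in the closed annulus, where the
   difference quotient is that of A ln r + B at [theta]. *)
apply (filter_imp (fun s => ball 0 d s /\ 0 < s < rho - theta)).
- intros s [Hs Hs2]. apply He.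
  assert (Hs0 : radius (circle_point (theta + s) t) = theta + s)
    by (apply radius_circle_point; lra).
  assert (H0 : radius (circle_point theta t) = theta)
    by (apply radius_circle_point; lra).
  rewrite !Hu, Hs0, H0 by (unfold closed_annulus; lra).
  apply Hd; [lra |].
  change (Rabs (s - 0) < d) in Hs. now rewrite Rminus_0_r in Hs.
- apply filter_and.
  + apply filter_le_within. now exists d.
  + apply (locally_interval _ _ m_infty (rho - theta)); simpl; auto; lra || intros; lra.
Qed.

(** The normal derivative is the constant A / theta on a circle of length 2 PI theta. Uniqueness of
    one-sided limits forces any admissible [g] to be this constant, so the flux determines A, which
    the uniqueness argument needs; the converse serves existence. *)
Lemma is_circle_flux_log (theta rho A B : R) (u : R * R -> R) :
  0 < theta < rho ->
  (forall z, closed_annulus rho theta z -> u z = A * ln (radius z) + B) ->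
  forall flux, is_circle_flux u theta flux <-> flux = 2 * PI * A.
Proof.
intros Ht Hu flux.
assert (HI : is_RInt (fun _ => A / theta * theta) 0 (2 * PI) (2 * PI * A)).
{ replace (2 * PI * A) with ((2 * PI - 0) * (A / theta * theta)) by (field; lra).
  apply (is_RInt_const (V := R_NormedModule)). }
split.
- intros (g & Hg & Hint).
  rewrite <- (is_RInt_unique _ _ _ _ HI). symmetry. apply is_RInt_unique.
  apply is_RInt_ext with (2 := Hint). intros t _. f_equal.
  apply (filterlim_locally_unique (F := at_right 0) _ _ _ (Hg t)).
  now apply (is_normal_derive_log theta rho A B).
- intros ->. exists (fun _ => A / theta). split; auto.
  intros t. now apply (is_normal_derive_log theta rho A B).
Qed.

(** * Solutions with prescribed flux and outer boundary value *)

Section Peaceman.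

Variables (k mu h q theta : R).
Hypotheses (hk : 0 < k) (hmu : 0 < mu) (hh : 0 < h) (htheta : 0 < theta).

(** The coefficient of ln r imposed by the rate q. It depends on neither the outer radius nor the
    outer value, so u1 and u0 share it. *)
Let A := alpha k mu h * q / (2 * PI).

Lemma flux_condition (a : R) : h * (k / mu) * (2 * PI * a) = q <-> a = A.
Proof.
pose proof PI_RGT_0. unfold A, alpha. split.
- intros <-. field. repeat split; lra.
- intros ->. field. repeat split; lra.
Qed.

(** The flux fixes the coefficient of ln r and the value at (rho, 0) fixes the additive constant, so
    a solution is unique on the closed annulus. *)
Lemma radial_solution_log (rho p : R) (u : R * R -> R) :
  theta < rho -> radial_solution k mu h q theta rho p u ->
  forall z, closed_annulus rho theta z -> u z = A * ln (radius z) + (p - A * ln rho).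
Proof.
intros Hrho (Hr & Hc & Hh & (flux & Hf & Hq) & Hp).
destruct (radial_harmonic_log_closed theta rho u) as (a & B & Hu); auto.
rewrite (is_circle_flux_log theta rho a B) in Hf by auto.
rewrite Hf in Hq. apply flux_condition in Hq. subst a.
assert (E : radius (rho, 0) = rho) by (apply radius_axis; lra).
pose proof (Hp (rho, 0) E) as Hp0.
rewrite Hu, E in Hp0 by (unfold closed_annulus; lra).
intros z Hz. rewrite Hu by assumption. lra.
Qed.

Lemma radial_solution_exists (rho p : R) :
  theta < rho -> exists u, radial_solution k mu h q theta rho p u.
Proof.
(* This B gives the profile the value p at radius rho. *)
intros Hrho. set (B := p - A * ln rho). exists (log_profile A B).
assert (Hu : forall z, closed_annulus rho theta z ->
  log_profile A B z = A * ln (radius z) + B).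
{ intros z Hz. apply log_profile_radius. destruct Hz; lra. }
split; [| split; [| split; [| split]]].
- intros z w Hz Hw E. now rewrite !Hu, E.
- apply continuous_on_forall. intros z Hz.
  assert (HN : 0 < fst z ^ 2 + snd z ^ 2) by (apply radius_pos_sqr; destruct Hz; lra).
  apply (continuous_Rplus (fun w => A / 2 * ln (fst w ^ 2 + snd w ^ 2)) (fun _ => B));
    [| apply continuous_const].
  apply (continuous_Rmult (fun _ => A / 2) (fun w => ln (fst w ^ 2 + snd w ^ 2)));
    [apply continuous_const |].
  apply (continuous_comp (fun w : R * R => fst w ^ 2 + snd w ^ 2) ln);
    [solve_continuous | now apply continuous_ln].
- apply harmonic_on_subset with (2 := log_profile_harmonic A B).
  intros z [Hz _]; lra.
- exists (2 * PI * A). split; [| now apply flux_condition].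
  now apply (is_circle_flux_log theta rho A B).
- intros z Hz. unfold circle in Hz.
  rewrite Hu by (unfold closed_annulus; lra). rewrite Hz. unfold B; ring.
Qed.

Lemma radial_solution_inner (rho p : R) (u : R * R -> R) :
  theta < rho -> radial_solution k mu h q theta rho p u ->
  forall z, circle theta z -> u z = p - A * (ln rho - ln theta).
Proof.
intros Hrho Hu z Hz. unfold circle in Hz.
rewrite (radial_solution_log rho p u) by (auto; unfold closed_annulus; lra).
rewrite Hz. ring.
Qed.

End Peaceman.

Theorem theorem4 (k mu h q L theta Delta p0 p1 R0 : R) (M : nat)
  (hk : 0 < k) (hmu : 0 < mu) (hh : 0 < h)
  (hL : 0 < L) (htheta : 0 < theta) (hM : (0 < M)%nat)
  (hDelta : Delta = L / INR M)
  (hDelta_gt : exp (PI / 2) * theta < Delta)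
  (hbalance : p1 - p0 = alpha k mu h / 4 * q)
  (hR0 : R0 = Delta * exp (- (PI / 2))) :
  strictly_well_posed k mu h q theta Delta p0 p1 /\
  strictly_well_posed_with k mu h q theta Delta p0 p1 R0.
Proof.
enough (H : strictly_well_posed_with k mu h q theta Delta p0 p1 R0)
  by (split; [now exists R0 | exact H]).
pose proof PI_RGT_0 as HPI.
assert (He : exp (PI / 2) * exp (- (PI / 2)) = 1)
  by (rewrite <- exp_plus, Rplus_opp_r; apply exp_0).
pose proof (exp_pos (PI / 2)) as He1. pose proof (exp_pos (- (PI / 2))) as He2.
assert (HDelta : 0 < Delta)
  by (apply Rlt_trans with (2 := hDelta_gt); now apply Rmult_lt_0_compat).
assert (HR1 : theta < R0).
(* The lower bound on [Delta] multiplied by exp(-PI/2) is exactly theta < R0. *)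
{ rewrite hR0. apply Rmult_lt_compat_r with (1 := He2) in hDelta_gt.
  apply Rle_lt_trans with (2 := hDelta_gt).
  replace theta with (theta * (exp (PI / 2) * exp (- (PI / 2)))) at 1
    by (rewrite He; ring). lra. }
assert (HR2 : R0 < Delta).
{ rewrite hR0. rewrite <- (Rmult_1_r Delta) at 2.
  apply Rmult_lt_compat_l; [assumption |].
  rewrite <- exp_0. apply exp_increasing. lra. }
(* Equivalent to ln(Delta / R0) = PI / 2, the only information on [R0] used in matching the inner
   values. *)
assert (Hln : ln R0 = ln Delta - PI / 2)
  by (rewrite hR0, ln_mult, ln_exp by assumption; ring).
split; [now split |].
split; [apply radial_solution_exists; auto; lra |].
split; [apply radial_solution_exists; auto; lra |].
split; [| exact hbalance].
intros u1 u0 H1 H0.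
pose proof (radial_solution_inner _ _ _ _ _ hk hmu hh htheta Delta p1 u1
  ltac:(lra) H1) as E1.
pose proof (radial_solution_inner _ _ _ _ _ hk hmu hh htheta R0 p0 u0 HR1 H0) as E0.
split; [eexists; exact E1 |]. split; [eexists; exact E0 |].
(* The inner values differ by p1 - p0 - A PI/2, where A PI/2 = (alpha q / (2 PI)) (PI/2) = alpha q /
   4, which the balance equation cancels. *)
intros z Hz. rewrite E1, E0, Hln by assumption.
replace p1 with (p0 + alpha k mu h / 4 * q) by lra. field. lra.
Qed.
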